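(* Let $A$ be an algebra, $\mathcal C$ an $A$-coring, $M$ a Galois right $\mathcal C$-comodule, and let $S=\mathrm{End}^{-\mathcal C}(M)$ and $\hat S=\mathrm{End}_{-A}(M)$. If either (a) $M$ is flat as a left $S$-module and there exists a left $S$-module map $\sigma:\hat S\to S$ such that $\sigma(1_{\hat S})=1_S$, or (b) $\mathcal C$ is flat as a left $A$-module and $S\to\hat S$ is a split extension, then $M$ is a faithfully flat left $S$-module.
   Context: Algebras are associative unital algebras over a commutative unital ring $k$. An $A$-coring $\mathcal C$ is an $(A,A)$-bimodule with coassociative coproduct $\Delta_{\mathcal C}:\mathcal C\to\mathcal C\otimes_A\mathcal C$ and counit $\varepsilon_{\mathcal C}:\mathcal C\to A$ (bimodule maps). $\mathrm{Hom}^{-\mathcal C}$ denotes right $\mathcal C$-colinear maps, $\mathrm{End}_{-A}$ right $A$-linear endomorphisms. $S$ and $\hat S$ are rings under composition, $S\subseteq\hat S$; $M$ is a left $S$-module and $\mathrm{Hom}^{-\mathcal C}(M,N)$ a right $S$-module via $fs=f\circ s$. A right $\mathcal C$-comodule $M$ is Galois if it is finitely generated and projective as a right $A$-module and $\mathrm{Hom}^{-\mathcal C}(M,\mathcal C)\otimes_S M\to\mathcal C$, $f\otimes m\mapsto f(m)$, is an isomorphism of right $\mathcal C$-comodules ($\mathcal C$ a comodule via $\Delta_{\mathcal C}$). A ring extension $S\to R$ is split if there is an $(S,S)$-bimodule map $\sigma:R\to S$ with $\sigma(1_R)=1_S$. *)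

(* Defs.v *)
From HB Require Import structures.
From mathcomp Require Import all_boot all_algebra.
From mathcomp Require Import boolp functions.
From mathcomp Require Import freeg.

Set Implicit Arguments.
Unset Strict Implicit.
Unset Printing Implicit Defensive.

Import GRing.Theory.
Local Open Scope ring_scope.
Local Open Scope quotient_scope.

Section ZmodMorphism.
Variables (U V : zmodType) (f : U -> V).

Lemma zmod_morph0 : zmod_morphism f -> f 0 = 0.
Proof. by move=> fB; rewrite -[X in f X](subrr 0) fB subrr. Qed.

Lemma zmod_morphD : zmod_morphism f -> {morph f : x y / x + y}.
Proof.
move=> fB x y; rewrite -[in LHS](opprK y) fB -[- y]sub0r fB.
by rewrite zmod_morph0 // sub0r opprK.
Qed.

Lemma morphD_zmod : {morph f : x y / x + y} -> zmod_morphism f.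
Proof.
by move=> fD x y; apply: (addIr (f y)); rewrite -fD !subrK.
Qed.

End ZmodMorphism.

(** * Algebras, right modules and bimodules *)

(* The library's [algType] excludes the zero ring; here an algebra is a
   possibly zero ring with a central ring morphism from [k]. *)
Record kalgebra (k : comPzRingType) := KAlgebra {
  kalg_ring :> pzRingType;
  kalg_map : {rmorphism k -> kalg_ring};
  kalg_central : forall c a, kalg_map c * a = a * kalg_map c
}.

HB.mixin Record Zmodule_isRmodule (R : pzRingType) V of GRing.Zmodule V := {
  rscale : V -> R -> V;
  rscalerA : forall v a b, rscale (rscale v a) b = rscale v (a * b);
  rscaler1 : forall v, rscale v 1 = v;
  rscalerDl : forall a, {morph rscale^~ a : u v / u + v};
  rscalerDr : forall v, {morph rscale v : a b / a + b}
}.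
#[short(type="rmodType")]
HB.structure Definition Rmodule (R : pzRingType) :=
  {V of GRing.Zmodule V & Zmodule_isRmodule R V}.

Notation "v :* a" := (rscale v a) : ring_scope.

HB.mixin Record isBimodule (R T : pzRingType) V
    of GRing.Lmodule R V & Rmodule T V := {
  bimodA : forall (a : R) (v : V) (b : T), (a *: v) :* b = a *: (v :* b)
}.
#[short(type="bimodType")]
HB.structure Definition Bimodule (R T : pzRingType) :=
  {V of GRing.Lmodule R V & Rmodule T V & isBimodule R T V}.

Section RegularBimodule.
Variable R : pzRingType.

Let regular_rscale (v : R^o) (a : R) : R^o := (v : R) * a.
Let regular_rscalerA v a b :
  regular_rscale (regular_rscale v a) b = regular_rscale v (a * b).
Proof. exact/esym/mulrA. Qed.
Let regular_rscaler1 v : regular_rscale v 1 = v.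
Proof. exact: mulr1. Qed.
Let regular_rscalerDl a : {morph regular_rscale^~ a : u v / u + v}.
Proof. by move=> u v; exact: mulrDl. Qed.
Let regular_rscalerDr v : {morph regular_rscale v : a b / a + b}.
Proof. by move=> a b; exact: mulrDr. Qed.

HB.instance Definition _ := Zmodule_isRmodule.Build R R^o
  regular_rscalerA regular_rscaler1 regular_rscalerDl regular_rscalerDr.

Let regular_bimodA (a : R) (v : R^o) (b : R) : (a *: v) :* b = a *: (v :* b).
Proof. exact/esym/mulrA. Qed.

HB.instance Definition _ := isBimodule.Build R R R^o regular_bimodA.

End RegularBimodule.

Section RightLinear.
Variable R : pzRingType.

Definition rlinear (X X' : rmodType R) (f : X -> X') : Prop :=
  zmod_morphism f /\ forall x a, f (x :* a) = f x :* a.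

Variables X X' : rmodType R.

Lemma rscaleN (x : X) a : (- x) :* a = - (x :* a).
Proof.
have h0 : (0 : X) :* a = 0.
  by apply: (addrI ((0 : X) :* a)); rewrite -rscalerDl !addr0.
by apply: (addrI (x :* a)); rewrite -rscalerDl !subrr.
Qed.

End RightLinear.

Section RightHom.
Variables (R : pzRingType) (X X' : rmodType R).

Definition rlinear_pred : {pred X -> X'} := fun f => `[< rlinear f >].

Lemma rlinear_zmod_closed : zmod_closed rlinear_pred.
Proof.
split=> [|f g /asboolP[fB fZ] /asboolP[gB gZ]]; apply/asboolP.
  split=> [x y|x a]; first by rewrite subr0.
  by apply: (addrI ((0 : X') :* a)); rewrite -rscalerDl !addr0.
have E h1 h2 x : (h1 - h2 : X -> X') x = h1 x - h2 x by [].
split=> [x y|x a]; rewrite !E; last by rewrite fZ gZ rscalerDl rscaleN.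
by rewrite fB gB !opprD !opprK addrACA.
Qed.
HB.instance Definition _ :=
  GRing.isZmodClosed.Build (X -> X') rlinear_pred rlinear_zmod_closed.

Definition rhom := {f : X -> X' | f \in rlinear_pred}.
HB.instance Definition _ := [isSub of rhom for @sval _ _].
HB.instance Definition _ := [Choice of rhom by <:].
HB.instance Definition _ := [SubChoice_isSubZmodule of rhom by <:].
Definition rhom_fun (f : rhom) : X -> X' := val f.
Coercion rhom_fun : rhom >-> Funclass.

Lemma rhomP (f : rhom) : rlinear f. Proof. by have /asboolP := valP f. Qed.
Lemma rhomB (f : rhom) : zmod_morphism f. Proof. by case: (rhomP f). Qed.
Lemma rhomZ (f : rhom) x a : f (x :* a) = f x :* a.
Proof. by case: (rhomP f). Qed.
Lemma rhomD (f : rhom) : {morph f : x y / x + y}.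
Proof.
exact: zmod_morphD (rhomB f).
Qed.

Definition mkrhom (f : X -> X') (fP : rlinear f) : rhom :=
  Sub f (introT (asboolP _) fP).

End RightHom.

(* the ring of right linear endomorphisms, multiplied by composition *)
Section RightEnd.
Variables (R : pzRingType) (X : rmodType R).

Definition rend := rhom X X.
HB.instance Definition _ := SubChoice.on rend.
HB.instance Definition _ := GRing.Zmodule.on rend.
Implicit Types f g h : rend.

Definition rend_fun f : X -> X := val f.
Coercion rend_fun : rend >-> Funclass.

Lemma rend_comp_subproof f g : rlinear (f \o g).
Proof.
have [[fB fZ] [gB gZ]] := (rhomP f, rhomP g).
split=> [x y|x a]; first exact: etrans (congr1 f (gB x y)) (fB _ _).
exact: etrans (congr1 f (gZ x a)) (fZ _ _).
Qed.
Lemma rend_id_subproof : rlinear (@id X). Proof. by []. Qed.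

Definition rend_mul f g : rend := mkrhom (rend_comp_subproof f g).
Definition rend_one : rend := mkrhom rend_id_subproof.

Lemma rend_mulA : associative rend_mul.
Proof. by move=> f g h; apply: val_inj. Qed.
Lemma rend_mul1 : left_id rend_one rend_mul.
Proof. by move=> f; apply: val_inj. Qed.
Lemma rend_mulr1 : right_id rend_one rend_mul.
Proof. by move=> f; apply: val_inj. Qed.
Lemma rend_mulDl : left_distributive rend_mul +%R.
Proof. by move=> f g h; apply: val_inj. Qed.
Lemma rend_mulDr : right_distributive rend_mul +%R.
Proof.
by move=> f g h; apply: val_inj; apply/funext => x; exact: (rhomD f).
Qed.
HB.instance Definition _ := GRing.Zmodule_isPzRing.Build rend
  rend_mulA rend_mul1 rend_mulr1 rend_mulDl rend_mulDr.
End RightEnd.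

(** * Tensor products over a ring *)

Section Tensor.
Variables (R : pzRingType) (X : rmodType R) (Y : lmodType R).

Definition fpair (x : X) (y : Y) : {freeg (X * Y)} := << (1 : int) *g (x, y) >>.

Inductive tensor_rel : {freeg (X * Y)} -> Prop :=
| tensor_rel0 : tensor_rel 0
| tensor_relB u v : tensor_rel u -> tensor_rel v -> tensor_rel (u - v)
| tensor_relDl x x' y :
    tensor_rel (fpair (x + x') y - fpair x y - fpair x' y)
| tensor_relDr x y y' :
    tensor_rel (fpair x (y + y') - fpair x y - fpair x y')
| tensor_relA x a y : tensor_rel (fpair (x :* a) y - fpair x (a *: y)).

Definition tensor_pred : {pred {freeg (X * Y)}} := fun d => `[< tensor_rel d >].

Lemma tensor_zmod_closed : zmod_closed tensor_pred.
Proof.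
split=> [|u v /asboolP hu /asboolP hv]; apply/asboolP.
  exact: tensor_rel0.
exact: tensor_relB.
Qed.
HB.instance Definition _ :=
  GRing.isZmodClosed.Build {freeg (X * Y)} tensor_pred tensor_zmod_closed.

Definition tensor_of of phant X & phant Y := Quotient.quot tensor_pred.
Local Notation tensor := (tensor_of (Phant X) (Phant Y)).
HB.instance Definition _ := GRing.Zmodule.on tensor.
HB.instance Definition _ := EqQuotient.on tensor.

Definition tens (x : X) (y : Y) : tensor := \pi_tensor (fpair x y).

Definition balanced (Z : zmodType) (b : X -> Y -> Z) : Prop :=
  [/\ forall y, {morph b^~ y : x x' / x + x'},
      forall x, {morph b x : y y' / y + y'} &
      forall x a y, b (x :* a) y = b x (a *: y)].

(* The additive map on the tensor product induced by a balanced map; it is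
   defined through a representative, and so has junk values if [b] is not
   balanced. *)
Definition tlift (Z : zmodType) (b : X -> Y -> Z) (t : tensor) : Z :=
  fglift (fun p => b p.1 p.2 : zmodule Z) (repr t).

Lemma piB u v : \pi_tensor (u - v) = \pi_tensor u - \pi_tensor v.
Proof. by rewrite !piE. Qed.

Lemma piD u v : \pi_tensor (u + v) = \pi_tensor u + \pi_tensor v.
Proof. by rewrite !piE. Qed.

Lemma tensor_relE u : tensor_rel u -> \pi_tensor u = 0.
Proof.
move=> hu; rewrite -[RHS](subrr (\pi_tensor u)) -piB subrr.
by apply/eqP; rewrite -Quotient.idealrBE subr0; apply/asboolP.
Qed.

Lemma tensDl x x' y : tens (x + x') y = tens x y + tens x' y.
Proof.
apply/eqP; rewrite -subr_eq0 opprD addrA -!piB.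
by apply/eqP/tensor_relE/tensor_relDl.
Qed.

Lemma tensDr x y y' : tens x (y + y') = tens x y + tens x y'.
Proof.
apply/eqP; rewrite -subr_eq0 opprD addrA -!piB.
by apply/eqP/tensor_relE/tensor_relDr.
Qed.

Lemma tensA x a y : tens (x :* a) y = tens x (a *: y).
Proof.
by apply/eqP; rewrite -subr_eq0 -piB; apply/eqP/tensor_relE/tensor_relA.
Qed.

Lemma tens0l y : tens 0 y = 0.
Proof. by apply: (addrI (tens 0 y)); rewrite -tensDl !addr0. Qed.

Lemma tensNl x y : tens (- x) y = - tens x y.
Proof. by apply: (addrI (tens x y)); rewrite -tensDl !subrr tens0l. Qed.

Lemma tens_balanced : balanced tens.
Proof.
by split=> *; [move=> x x'; exact: tensDl | move=> y y'; exact: tensDr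
  | exact: tensA].
Qed.

Lemma tens_ind (P : tensor -> Prop) :
    (forall x y, P (tens x y)) -> (forall s t, P s -> P t -> P (s + t)) ->
  forall t, P t.
Proof.
move=> hT hD; elim/quotW; elim/freeg_ind_dom0 => [|m [x y] D _ _ IH].
  by have := hT 0 0; rewrite tens0l piE.
rewrite piD; apply: (hD _ _ _ IH).
have -> : << m *g (x, y) >> = fpair x y *~ m.
  by rewrite /fpair freeg_mulz intz.
have piN n : \pi_tensor (fpair x y *+ n) = tens x y *+ n.
  elim: n => [|n IHn]; first exact: tensor_relE tensor_rel0.
  by rewrite !mulrS piD IHn.
have hN n x' : P (tens x' y *+ n).
  case: n => [|n]; first by rewrite mulr0n -(tens0l y).
  elim: n => [|n IHn]; first exact: hT.
  by rewrite mulrS; apply: hD.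
case: m => n; first by rewrite -pmulrn piN.
rewrite NegzE mulrNz -[X in \pi_tensor X]sub0r piB -pmulrn piN.
by rewrite (tensor_relE tensor_rel0) sub0r -mulNrn -tensNl.
Qed.

Section Lift.
Variables (Z : zmodType) (b : X -> Y -> Z).
Hypothesis bP : balanced b.

Local Notation fl := (fglift (fun p : X * Y => b p.1 p.2 : zmodule Z)).

Let flB : zmod_morphism fl. Proof. exact: lift_is_additive. Qed.

Lemma tlift_pi d : tlift b (\pi_tensor d) = fl d.
Proof.
have fl0 u : tensor_rel u -> fl u = 0.
  have flE x y : fl (fpair x y) = b x y by rewrite liftU scale1r.
  have [bDl bDr bA] := bP.
  elim=> [|{}u v _ hu _ hv|x x' y|x y y'|x a y].
  - by rewrite -(subr0 0) flB subrr.
  - by rewrite flB hu hv subr0.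
  - by rewrite !flB !flE bDl -addrA -opprD subrr.
  - by rewrite !flB !flE bDr -addrA -opprD subrr.
  - by rewrite !flB !flE bA subrr.
apply/eqP; rewrite -subr_eq0 -flB; apply/eqP/fl0/asboolP.
by have := Quotient.idealrBE tensor_pred (repr (\pi_tensor d)) d;
  rewrite reprK eqxx.
Qed.

Lemma tlift_tens x y : tlift b (tens x y) = b x y.
Proof. by rewrite tlift_pi liftU scale1r. Qed.

Lemma tliftB : zmod_morphism (tlift b).
Proof.
by elim/quotW=> u; elim/quotW=> v; rewrite -piB !tlift_pi flB.
Qed.

Lemma tliftD : {morph tlift b : s t / s + t}.
Proof.
exact: zmod_morphD tliftB.
Qed.

End Lift.
End Tensor.

(* unfolding makes unification of nested tensor products intractable *)
Opaque tensor_of.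

(* The [phant] arguments let the module structures be inferred from the types
   [X] and [Y]; the ring is then inferred from the structures. *)
Notation "X *t Y" := (tensor_of (Phant X) (Phant Y))
  (at level 40, left associativity) : type_scope.

Section TensorTheory.
Variables (R : pzRingType) (X : rmodType R) (Y : lmodType R).

Lemma tens_ext (Z : zmodType) (f g : X *t Y -> Z) :
    {morph f : s t / s + t} -> {morph g : s t / s + t} ->
    (forall x y, f (tens x y) = g (tens x y)) ->
  f =1 g.
Proof. by move=> fD gD fg; elim/tens_ind => // s t; rewrite fD gD => -> ->. Qed.

End TensorTheory.

Section TensorMap.
Variable R : pzRingType.

(* [f (x) g]; meaningful for [f] right linear and [g] left linear. *)
Definition tmap (X X' : rmodType R) (Y Y' : lmodType R)
    (f : X -> X') (g : Y -> Y') : X *t Y -> X' *t Y' :=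
  tlift (fun x y => tens (f x) (g y)).

Lemma linear_id (Y : lmodType R) : linear (@id Y). Proof. by []. Qed.
Lemma rlinear_id (X : rmodType R) : rlinear (@id X). Proof. by []. Qed.

Lemma linear_morphD (Y Y' : lmodType R) (g : Y -> Y') :
  linear g -> {morph g : y y' / y + y'}.
Proof. by move=> gP y y'; rewrite -[y]scale1r gP !scale1r. Qed.

Lemma linear_morphZ (Y Y' : lmodType R) (g : Y -> Y') :
  linear g -> forall a y, g (a *: y) = a *: g y.
Proof.
move=> gP a y; have gD := linear_morphD gP.
have g0 : g 0 = 0 by apply: (addrI (g 0)); rewrite -gD !addr0.
by rewrite -[a *: y]addr0 gP g0 addr0.
Qed.

Lemma rlinear_morphD (X X' : rmodType R) (f : X -> X') :
  rlinear f -> {morph f : x x' / x + x'}.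
Proof. by case=> /zmod_morphD. Qed.

Section Balanced.
Variables (X X' : rmodType R) (Y Y' : lmodType R).
Variables (f : X -> X') (g : Y -> Y').
Hypotheses (fP : rlinear f) (gP : linear g).

Lemma tmap_balanced : balanced (fun x y => tens (f x) (g y)).
Proof.
split=> [y x x'|x y y'|x a y].
- by rewrite (rlinear_morphD fP) tensDl.
- by rewrite (linear_morphD gP) tensDr.
- by rewrite (fP.2 x a) (linear_morphZ gP) tensA.
Qed.

Lemma tmap_tens x y : tmap f g (tens x y) = tens (f x) (g y).
Proof. exact: (tlift_tens tmap_balanced). Qed.

Lemma tmapD : {morph tmap f g : s t / s + t}.
Proof. exact: (tliftD tmap_balanced). Qed.

Lemma tmapB : zmod_morphism (tmap f g).
Proof. exact: (tliftB tmap_balanced). Qed.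

End Balanced.

Lemma tmap_id (X : rmodType R) (Y : lmodType R) :
  tmap (@id X) (@id Y) =1 id.
Proof.
by apply: tens_ext => [||x y] //; [apply: tmapD | apply: tmap_tens].
Qed.

Lemma tmap_comp (X X' X'' : rmodType R) (Y Y' Y'' : lmodType R)
    (f : X -> X') (f' : X' -> X'') (g : Y -> Y') (g' : Y' -> Y'') :
    rlinear f -> rlinear f' -> linear g -> linear g' ->
  forall t, tmap f' g' (tmap f g t) = tmap (f' \o f) (g' \o g) t.
Proof.
move=> fP f'P gP g'P.
have ffP : rlinear (f' \o f).
  by split=> [x y|x a] /=; rewrite ?fP.1 ?f'P.1 ?fP.2 ?f'P.2.
have ggP : linear (g' \o g) by move=> a x y /=; rewrite gP g'P.
apply: tens_ext => [s t|s t|x y].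
- by rewrite (tmapD fP gP) (tmapD f'P g'P).
- by rewrite (tmapD ffP ggP).
- by rewrite (tmap_tens fP gP) (tmap_tens f'P g'P) (tmap_tens ffP ggP).
Qed.

Lemma tmapDl (X X' : rmodType R) (Y Y' : lmodType R)
    (f f1 f2 : X -> X') (g : Y -> Y') :
    rlinear f -> rlinear f1 -> rlinear f2 -> linear g ->
    (forall x, f x = f1 x + f2 x) ->
  forall t, tmap f g t = tmap f1 g t + tmap f2 g t.
Proof.
move=> fP f1P f2P gP E; apply: tens_ext => [s t|s t|x y].
- exact: tmapD.
- by rewrite (tmapD f1P gP) (tmapD f2P gP) addrACA.
- by rewrite !tmap_tens // E tensDl.
Qed.

Lemma tmap_ext (X X' : rmodType R) (Y Y' : lmodType R)
    (f f1 : X -> X') (g g1 : Y -> Y') :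
  f =1 f1 -> g =1 g1 -> tmap f g =1 tmap f1 g1.
Proof. by move=> /funext -> /funext ->. Qed.

End TensorMap.

Section TensorLmodule.
Variables (S R : pzRingType) (X : bimodType S R) (Y : lmodType R).

Let rlin_scale (a : S) : rlinear ( *:%R a : X -> X).
Proof. by split=> [x y|x b]; rewrite ?scalerBr ?bimodA. Qed.

Definition tscale (a : S) (t : X *t Y) : X *t Y :=
  tmap ( *:%R a : X -> X) id t.

Lemma tscale_tens a x y : tscale a (tens x y) = tens (a *: x) y.
Proof. exact: (tmap_tens (rlin_scale a) (@linear_id _ _)). Qed.

Let tscaleD a : {morph tscale a : s t / s + t}.
Proof. exact: (tmapD (rlin_scale a) (@linear_id _ _)). Qed.

Lemma tscaleA a b t : tscale a (tscale b t) = tscale (a * b) t.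
Proof.
by elim/tens_ind: t => [x y|s t]; rewrite ?tscale_tens ?scalerA // !tscaleD => -> ->.
Qed.
Lemma tscale1 : left_id 1 tscale.
Proof.
by elim/tens_ind=> [x y|s t]; rewrite ?tscale_tens ?scale1r // !tscaleD => -> ->.
Qed.
Lemma tscaleDr : right_distributive tscale +%R.
Proof. by move=> a s t; exact: tscaleD. Qed.
Lemma tscaleDl t : {morph tscale^~ t : a b / a + b}.
Proof.
move=> a b; elim/tens_ind: t => [x y|s t].
  by rewrite !tscale_tens scalerDl tensDl.
by rewrite !tscaleD => -> ->; rewrite addrACA.
Qed.

HB.instance Definition _ := GRing.Zmodule_isLmodule.Build S (X *t Y)
  tscaleA tscale1 tscaleDr tscaleDl.

Lemma scale_tens (a : S) x y : a *: (tens x y : X *t Y) = tens (a *: x) y.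
Proof. exact: tscale_tens. Qed.

End TensorLmodule.

Section TensorRmodule.
Variables (R T : pzRingType) (X : rmodType R) (Y : bimodType R T).

Let lin_scale (b : T) : linear (fun y : Y => y :* b).
Proof. by move=> a x y; rewrite rscalerDl bimodA. Qed.

Definition trscale (t : X *t Y) (b : T) : X *t Y :=
  tmap id (fun y : Y => y :* b) t.

Lemma trscale_tens x y b : trscale (tens x y) b = tens x (y :* b).
Proof. exact: (tmap_tens (@rlinear_id _ _) (lin_scale b)). Qed.

Lemma trscaleDl b : {morph trscale^~ b : s t / s + t}.
Proof. exact: (tmapD (@rlinear_id _ _) (lin_scale b)). Qed.

Lemma trscaleA t a b : trscale (trscale t a) b = trscale t (a * b).
Proof.
elim/tens_ind: t => [x y|s t]; first by rewrite !trscale_tens rscalerA.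
by rewrite !trscaleDl => -> ->.
Qed.
Lemma trscale1 t : trscale t 1 = t.
Proof.
elim/tens_ind: t => [x y|s t]; first by rewrite !trscale_tens rscaler1.
by rewrite !trscaleDl => -> ->.
Qed.
Lemma trscaleDr t : {morph trscale t : a b / a + b}.
Proof.
move=> a b; elim/tens_ind: t => [x y|s t].
  by rewrite !trscale_tens rscalerDr tensDr.
by rewrite !trscaleDl => -> ->; rewrite addrACA.
Qed.

HB.instance Definition _ := Zmodule_isRmodule.Build T (X *t Y)
  trscaleA trscale1 trscaleDl trscaleDr.

Lemma rscale_tens x y (b : T) : (tens x y : X *t Y) :* b = tens x (y :* b).
Proof. exact: trscale_tens. Qed.

End TensorRmodule.

Section TensorBimodule.
Variables (S R T : pzRingType) (X : bimodType S R) (Y : bimodType R T).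

Lemma tensor_bimodA (a : S) (t : X *t Y) (b : T) :
  (a *: t) :* b = a *: (t :* b).
Proof.
elim/tens_ind: t => [x y|s t].
  by rewrite !(scale_tens, rscale_tens).
by rewrite !(scalerDr, rscalerDl) => -> ->.
Qed.

HB.instance Definition _ := isBimodule.Build S T ((X *t Y)) tensor_bimodA.

End TensorBimodule.

Section TensorAssoc.
Variables (R T : pzRingType) (X : rmodType R) (Y : bimodType R T).
Variable Z : lmodType T.

Definition tassoc : (X *t Y) *t Z -> X *t (Y *t Z) :=
  tlift (fun t z => tlift (fun x y => tens x (tens y z)) t).

Let inner_balanced (z : Z) :
  balanced (fun x y => tens x (tens y z) : X *t (Y *t Z)).
Proof.
split=> [y x x'|x y y'|x a y]; first by rewrite tensDl.
  by rewrite tensDl tensDr.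
by rewrite -scale_tens tensA.
Qed.

Let outer_balanced : balanced (fun (t : X *t Y) z =>
  tlift (fun x y => tens x (tens y z) : X *t (Y *t Z)) t).
Proof.
split=> [z s t|t z z'|t a z]; first exact: tliftD.
  elim/tens_ind: t => [x y|s t]; first by rewrite !tlift_tens // !tensDr.
  by rewrite !tliftD // => -> ->; rewrite addrACA.
elim/tens_ind: t => [x y|s t].
  by rewrite rscale_tens !tlift_tens // tensA.
by rewrite rscalerDl !tliftD // => -> ->.
Qed.

Lemma tassoc_tens x y z : tassoc (tens (tens x y) z) = tens x (tens y z).
Proof. by rewrite /tassoc !tlift_tens. Qed.

Lemma tassocD : {morph tassoc : s t / s + t}.
Proof. exact: tliftD outer_balanced. Qed.

End TensorAssoc.

Section TensorUnit.
Variable R : pzRingType.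

Definition tunitl (Y : lmodType R) : R^o *t Y -> Y :=
  tlift (fun (a : R^o) (y : Y) => (a : R) *: y).

Definition tunitr (X : rmodType R) : X *t R^o -> X :=
  tlift (fun (x : X) (a : R^o) => x :* (a : R)).

Lemma tunitl_tens (Y : lmodType R) (a : R) (y : Y) :
  tunitl (tens (a : R^o) y) = a *: y.
Proof.
rewrite /tunitl tlift_tens //.
split=> [z b b'|b z z'|b c z]; first exact: scalerDl.
  exact: scalerDr.
by rewrite scalerA.
Qed.

Lemma tunitr_balanced (X : rmodType R) :
  balanced (fun (x : X) (a : R^o) => x :* (a : R)).
Proof.
split=> [a x x'|x a a'|x a y]; first exact: rscalerDl.
  exact: rscalerDr.
exact: rscalerA.
Qed.

Lemma tunitr_tens (X : rmodType R) (x : X) (a : R) :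
  tunitr (tens x (a : R^o)) = x :* a.
Proof. exact: (tlift_tens (tunitr_balanced X)). Qed.

Lemma tunitrD (X : rmodType R) : {morph @tunitr X : s t / s + t}.
Proof. exact: (tliftD (tunitr_balanced X)). Qed.

End TensorUnit.

Section TensorNatural.
Variables (R T : pzRingType) (X X' : rmodType R) (f : X -> X').
Hypothesis fP : rlinear f.

Lemma tmap_rlinear (Y : bimodType R T) :
  rlinear (tmap f id : X *t Y -> X' *t Y).
Proof.
split=> [|t a]; first exact: tmapB.
elim/tens_ind: t => [x y|s t].
  by rewrite rscale_tens !tmap_tens // rscale_tens.
by rewrite rscalerDl !tmapD // rscalerDl => -> ->.
Qed.

Lemma tmap_tassoc (Y : bimodType R T) (Z : lmodType T)
    (t : (X *t Y) *t Z) :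
  tassoc (tmap (tmap f id) id t) = tmap f id (tassoc t).
Proof.
have ffP := tmap_rlinear Y; have idP := @linear_id T Z.
have D1 (u v : (X *t Y) *t Z) : tassoc (tmap (tmap f id) id (u + v)) =
    tassoc (tmap (tmap f id) id u) + tassoc (tmap (tmap f id) id v).
  by rewrite (tmapD ffP idP) tassocD.
have D2 (u v : (X *t Y) *t Z) : tmap f id (tassoc (u + v)) =
    tmap f id (tassoc u) + tmap f id (tassoc v).
  by rewrite tassocD (tmapD fP (@linear_id _ _)).
elim/tens_ind: t => [s z|s t]; last by rewrite D1 D2 => -> ->.
elim/tens_ind: s => [x y|s t hs ht]; last first.
  by rewrite tensDl D1 D2 hs ht.
rewrite (tmap_tens ffP idP) !tassoc_tens (tmap_tens fP (@linear_id _ _)).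
by rewrite (tmap_tens fP (@linear_id _ _)) tassoc_tens.
Qed.

Lemma tmap_tunitr (t : X *t R^o) : tunitr (tmap f id t) = f (tunitr t).
Proof.
have fD := rlinear_morphD fP.
elim/tens_ind: t => [x a|s t].
  by rewrite tmap_tens // !tunitr_tens fP.2.
by rewrite tmapD // !tunitrD fD => -> ->.
Qed.

End TensorNatural.

(** * Corings and comodules *)

Section Corings.
Variables (k : comPzRingType) (A : kalgebra k).

Record coring := Coring {
  coring_bimod :> bimodType A A;
  (* [k] acts in the same way on both sides, as it does on all bimodules over
     a [k]-algebra *)
  coring_central : forall (c : k) (x : coring_bimod),
    kalg_map A c *: x = x :* kalg_map A c;
  comul : coring_bimod -> coring_bimod *t coring_bimod;
  comul_linear : linear comul;
  comul_rlinear : rlinear comul;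
  counit : coring_bimod -> A^o;
  counit_linear : linear counit;
  counit_rlinear : rlinear counit;
  comulA : forall x, tassoc (tmap comul id (comul x)) = tmap id comul (comul x);
  comul_counitl : forall x, tunitl (tmap counit id (comul x)) = x;
  comul_counitr : forall x, tunitr (tmap id counit (comul x)) = x
}.

Variable C : coring.

Record comodule := Comodule {
  comod_rmod :> rmodType A;
  coact : comod_rmod -> comod_rmod *t C;
  coact_rlinear : rlinear coact;
  coactA : forall m,
    tassoc (tmap coact id (coact m)) = tmap id (@comul C) (coact m);
  coact_counit : forall m, tunitr (tmap id (@counit C) (coact m)) = m
}.

Definition regular_comodule : comodule :=
  @Comodule C (@comul C) (@comul_rlinear C) (@comulA C) (@comul_counitr C).

Definition colinear (M N : comodule) (f : M -> N) : Prop :=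
  rlinear f /\ forall m, coact (f m) = tmap f id (coact m).

(* an isomorphism in the category of right comodules *)
Definition comodule_iso (M N : comodule) (f : M -> N) : Prop :=
  colinear f /\
  exists g : N -> M, [/\ colinear g, cancel f g & cancel g f].

Section ComoduleHom.
Variables M N : comodule.

Definition colinear_pred : {pred rhom M N} := fun f => `[< colinear f >].

Lemma colinear_zmod_closed : zmod_closed colinear_pred.
Proof.
have idP := @linear_id _ C.
split=> [|f g /asboolP fP /asboolP gP]; apply/asboolP.
  split=> [|m]; first exact: rhomP.
  have -> : forall t, tmap (0 : rhom M N) id t = 0 :> N *t C.
    elim/tens_ind => [x y|s t hs ht].
      by rewrite (tmap_tens (rhomP _) idP) tens0l.
    by rewrite (tmapD (rhomP _) idP) hs ht addr0.
  exact: (zmod_morph0 (@coact_rlinear N).1).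
have subP (u v : rhom M N) : colinear u -> colinear v ->
      colinear (u - v : rhom M N).
  move=> [_ uC] [_ vC]; split=> [|m]; first exact: rhomP.
  have E : coact (u m) = tmap (u - v : rhom M N) id (coact m) + coact (v m).
    rewrite vC -(tmapDl (f := u)) //; try exact: rhomP.
    by move=> x; symmetry; exact: subrK.
  have -> : (u - v : rhom M N) m = u m - v m by [].
  by rewrite (@coact_rlinear N).1 E addrK.
exact: subP.
Qed.
HB.instance Definition _ :=
  GRing.isZmodClosed.Build (rhom M N) colinear_pred colinear_zmod_closed.

Definition chom := {f : rhom M N | f \in colinear_pred}.
HB.instance Definition _ := [isSub of chom for @sval _ _].
HB.instance Definition _ := [Choice of chom by <:].
HB.instance Definition _ := [SubChoice_isSubZmodule of chom by <:].
Definition chom_fun (f : chom) : M -> N := rhom_fun (val f).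
Coercion chom_fun : chom >-> Funclass.

Lemma chomP (f : chom) : colinear f. Proof. by have /asboolP := valP f. Qed.

Definition mkchom (f : M -> N) (fP : colinear f) : chom :=
  Sub (mkrhom fP.1) (introT (asboolP _) fP).

End ComoduleHom.

Lemma colinear_comp (L M N : comodule) (g : M -> N) (f : L -> M) :
  colinear g -> colinear f -> colinear (g \o f).
Proof.
move=> [gP gC] [fP fC]; split=> [|m].
  by split=> [x y|x a] /=; rewrite ?fP.1 ?gP.1 ?fP.2 ?gP.2.
by rewrite /= gC fC tmap_comp.
Qed.

Lemma colinear_id (M : comodule) : colinear (@id M).
Proof. by split=> // m; rewrite tmap_id. Qed.

(* the colinear endomorphisms, as a subring of [rend M] *)
Section ComoduleEnd.
Variable M : comodule.

Definition cend_pred : {pred rend M} := fun f => `[< colinear (f : M -> M) >].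

Lemma cend_subring_closed : subring_closed cend_pred.
Proof.
split=> [|f g|f g /asboolP fP /asboolP gP].
- by apply/asboolP; exact: colinear_id.
- exact: (colinear_zmod_closed M M).2.
- by apply/asboolP; exact: colinear_comp.
Qed.
HB.instance Definition _ :=
  GRing.isSubringClosed.Build (rend M) cend_pred cend_subring_closed.

Definition cend := {f : rend M | f \in cend_pred}.
HB.instance Definition _ := [isSub of cend for @sval _ _].
HB.instance Definition _ := [Choice of cend by <:].
HB.instance Definition _ := GRing.SubChoice_isSubPzRing.Build
  (rend M) cend_pred cend cend_subring_closed.
Definition cend_fun (s : cend) : M -> M := val s.
Coercion cend_fun : cend >-> Funclass.

Lemma cendP (s : cend) : colinear s. Proof. by have /asboolP := valP s. Qed.

Definition cend_incl : {rmorphism cend -> rend M} := val.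

(* [M] as a bimodule, its colinear endomorphisms acting on the left *)
Definition over_end : Type := M.
HB.instance Definition _ := GRing.Zmodule.on over_end.
HB.instance Definition _ := Rmodule.copy over_end M.

Definition end_scale (s : cend) (m : over_end) : over_end := s m.

Lemma end_scaleA s t m : end_scale s (end_scale t m) = end_scale (s * t) m.
Proof. by []. Qed.
Lemma end_scale1 : left_id 1 end_scale.
Proof. by []. Qed.
Lemma end_scaleDr : right_distributive end_scale +%R.
Proof. by move=> s m n; exact: (zmod_morphD (cendP s).1.1). Qed.
Lemma end_scaleDl m : {morph end_scale^~ m : s t / s + t}.
Proof. by []. Qed.

HB.instance Definition _ := GRing.Zmodule_isLmodule.Build cend over_end
  end_scaleA end_scale1 end_scaleDr end_scaleDl.

Lemma over_end_bimodA (s : cend) (m : over_end) (a : A) :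
  (s *: m) :* a = s *: (m :* a).
Proof. exact: (esym ((cendP s).1.2 (m : M) a)). Qed.

HB.instance Definition _ := isBimodule.Build cend A over_end over_end_bimodA.

End ComoduleEnd.

Section ComoduleHomRmodule.
Variables M N : comodule.

Definition chom_comp (f : chom M N) (s : cend M) : chom M N :=
  mkchom (colinear_comp (chomP f) (cendP s)).

Lemma chom_compA f s t : chom_comp (chom_comp f s) t = chom_comp f (s * t).
Proof. by do 2!apply: val_inj. Qed.
Lemma chom_comp1 f : chom_comp f 1 = f.
Proof. by do 2!apply: val_inj. Qed.
Lemma chom_compDl s : {morph chom_comp^~ s : f g / f + g}.
Proof. by move=> f g; do 2!apply: val_inj. Qed.
Lemma chom_compDr f : {morph chom_comp f : s t / s + t}.
Proof.
move=> s t; do 2!apply: val_inj; apply/funext => m.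
exact: (zmod_morphD (chomP f).1.1 (s m) (t m)).
Qed.
HB.instance Definition _ := Zmodule_isRmodule.Build (cend M) (chom M N)
  chom_compA chom_comp1 chom_compDl chom_compDr.

End ComoduleHomRmodule.

Section TensorComodule.
Variables (M : comodule) (X : rmodType (cend M)).
Local Notation XM := (X *t over_end M).

Definition tens_with (x : X) (m : M) : XM := tens x (m : over_end M).

Let tens_rlinear (x : X) : rlinear (tens_with x).
Proof.
split=> [|m a]; last by exact: (esym (rscale_tens x (m : over_end M) a)).
apply: morphD_zmod => m n.
exact: (@tensDr (cend M) X (over_end M) x m n).
Qed.

(* [x (x) m |-> (x (x) m_0) (x) m_1] *)
Definition tensor_coact : XM -> XM *t C :=
  tlift (fun (x : X) (m : over_end M) =>
    tmap (tens_with x) id (coact (m : M))).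

Let coactD := zmod_morphD (@coact_rlinear M).1.
Let idP := @linear_id _ C.

Let coact_balanced : balanced (fun (x : X) (m : over_end M) =>
  tmap (tens_with x) id (coact (m : M))).
Proof.
split=> [m x x'|x m m'|x s m].
- apply: (tmapDl (tens_rlinear (x + x')) (tens_rlinear x) (tens_rlinear x')
    idP) => m'.
  exact: (tensDl x x' (m' : over_end M)).
- by rewrite -(tmapD (tens_rlinear x) idP) -coactD.
- have [sP sC] := cendP s.
  have -> : coact (s *: m : over_end M) =
      tmap (cend_fun s) id (coact (m : M)) := sC m.
  rewrite (tmap_comp sP (tens_rlinear x) idP idP).
  by apply: tmap_ext => // m'; exact: tensA.
Qed.

Lemma tensor_coact_tens x (m : over_end M) :
  tensor_coact (tens x m) = tmap (tens_with x) id (coact (m : M)).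
Proof. exact: tlift_tens. Qed.

Lemma tensor_coactD : {morph tensor_coact : s t / s + t}.
Proof. exact: tliftD. Qed.

Lemma tensor_coact_rlinear : rlinear tensor_coact.
Proof.
split=> [|t a]; first exact: tliftB.
elim/tens_ind: t => [x m|s t].
  rewrite rscale_tens !tensor_coact_tens [coact _](@coact_rlinear M).2.
  exact: (tmap_rlinear (tens_rlinear x) C).2.
by rewrite rscalerDl !tensor_coactD rscalerDl => -> ->.
Qed.

Let coactP := tensor_coact_rlinear.

Lemma tensor_coactA t :
  tassoc (tmap tensor_coact id (tensor_coact t)) =
  tmap id (@comul C) (tensor_coact t).
Proof.
have D1 := tmapD coactP idP.
have D2 := tmapD (@rlinear_id _ XM) (@comul_linear C).
elim/tens_ind: t => [x m|s t]; last first.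
  by rewrite !tensor_coactD D1 D2 tassocD => -> ->.
have xP := tens_rlinear x; rewrite tensor_coact_tens.
rewrite (tmap_comp xP coactP idP idP).
rewrite (tmap_comp xP (@rlinear_id _ _) idP (@comul_linear C)).
rewrite (tmap_ext (f1 := tmap (tens_with x) id \o @coact M) (g1 := id \o id));
  [|by move=> m'; exact: tensor_coact_tens|by []].
rewrite -(tmap_comp (@coact_rlinear M) (tmap_rlinear xP C) idP idP).
rewrite tmap_tassoc // coactA.
by rewrite (tmap_comp (@rlinear_id _ M) xP (@comul_linear C) (@linear_id _ _)).
Qed.

Lemma tensor_coact_counit t :
  tunitr (tmap id (@counit C) (tensor_coact t)) = t.
Proof.
elim/tens_ind: t => [x m|s t]; last first.
  rewrite tensor_coactD (tmapD (@rlinear_id _ XM) (@counit_linear C)).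
  by rewrite tunitrD => -> ->.
have xP := tens_rlinear x; rewrite tensor_coact_tens.
rewrite (tmap_comp xP (@rlinear_id _ XM) idP (@counit_linear C)).
rewrite -[RHS](congr1 (tens_with x) (coact_counit (m : M))).
rewrite -(tmap_tunitr xP).
by rewrite (tmap_comp (@rlinear_id _ M) xP (@counit_linear C) (@linear_id _ _)).
Qed.

Definition tensor_comodule : comodule :=
  Comodule tensor_coact_rlinear tensor_coactA tensor_coact_counit.

End TensorComodule.

End Corings.

(** * Flatness, projectivity, split extensions, Galois comodules *)

Section ModuleProperties.
Variable R : pzRingType.

Definition exact_at (U V W : zmodType) (f : U -> V) (g : V -> W) : Prop :=
  forall v, g v = 0 <-> exists u, f u = v.

Definition flat (Y : lmodType R) : Prop :=
  forall (X1 X2 X3 : rmodType R) (f : X1 -> X2) (g : X2 -> X3),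
    rlinear f -> rlinear g ->
    exact_at f g -> exact_at (tmap f (@id Y)) (tmap g (@id Y)).

Definition faithfully_flat (Y : lmodType R) : Prop :=
  forall (X1 X2 X3 : rmodType R) (f : X1 -> X2) (g : X2 -> X3),
    rlinear f -> rlinear g ->
    (exact_at f g <-> exact_at (tmap f (@id Y)) (tmap g (@id Y))).

Definition finitely_generated (X : rmodType R) : Prop :=
  exists n (e : 'I_n -> X), forall x, exists a : 'I_n -> R,
    x = \sum_(i < n) e i :* a i.

Definition projective (X : rmodType R) : Prop :=
  forall (U V : rmodType R) (p : U -> V) (f : X -> V),
    rlinear p -> (forall v, exists u, p u = v) -> rlinear f ->
    exists2 h : X -> U, rlinear h & forall x, p (h x) = f x.

End ModuleProperties.

Section RingExtension.
Variables (S R : pzRingType) (i : {rmorphism S -> R}).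

Definition left_module_map (sigma : R -> S) : Prop :=
  zmod_morphism sigma /\ forall s r, sigma (i s * r) = s * sigma r.

Definition right_module_map (sigma : R -> S) : Prop :=
  zmod_morphism sigma /\ forall r s, sigma (r * i s) = sigma r * s.

Definition split_extension : Prop :=
  exists sigma : R -> S,
    [/\ left_module_map sigma, right_module_map sigma & sigma 1 = 1].

End RingExtension.

Section Galois.
Variables (k : comPzRingType) (A : kalgebra k) (C : coring A).
Variable M : comodule C.

Definition galois_map :
    tensor_comodule (chom M (regular_comodule C)) -> regular_comodule C :=
  tlift (fun (f : chom M (regular_comodule C)) (m : over_end M) => f m).

Lemma galois_map_tens (f : chom M (regular_comodule C)) (m : over_end M) :
  galois_map (tens f m) = f m.
Proof.
rewrite /galois_map tlift_tens //; split=> [n g h|g n n'|g s n] //.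
exact: (zmod_morphD (chomP g).1.1 n n').
Qed.

Definition galois : Prop :=
  [/\ finitely_generated M, projective M & comodule_iso galois_map].

End Galois.

(* Main.v *)
Require Import Defs.
From HB Require Import structures.
From mathcomp Require Import all_boot all_algebra.

Set Implicit Arguments.
Unset Strict Implicit.
Unset Printing Implicit Defensive.

Import GRing.Theory.
Local Open Scope ring_scope.

(** Write [H] for the colinear maps from [M] to [C] and [eps] for the counit of
    [C], and let [(e_i, phi_i)] be a finite dual basis of the right [A]-module [M]. A form [phi : M -> A] turns
    [m] in [M] into the rank one endomorphism [n |-> m (phi n)] of [M] over [A],
    and the identity is the sum of those given by [e_i] and [phi_i].

    Flatness is the same as faithful flatness here. If [sigma] is left
    [S]-linear, then [m |-> sigma (m (phi -))] is a left [S]-linear form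
    [tau_phi] on [M], and [sum_i tau_(phi_i) e_i = sigma 1 = 1]: the left
    module [M] is a generator. Every [x] in a right [S]-module [X] is then
    recovered as [sum_i x (tau_(phi_i) e_i)] from the tensors [x (x) e_i],
    naturally in [X], so tensoring with [M] reflects exactness
    ([flat_generator_faithfully_flat], [end_form_dual_basis]). This settles
    case (a), and reduces case (b) to the flatness of [M] over [S].

    For the latter, the coaction [X (x)_S M -> (X (x)_S M) (x)_A C] has a
    retraction that is natural in [X] ([coact_retractK]). By the Galois property
    [C] is spanned by the values [f m] of the maps [f] in [H], and the
    retraction sends [t (x) f m] to [tau_(eps f) t (x) m], where
    [tau_(eps f)] is evaluated on [t] in [X (x)_S M] with a value in [X]. The
    right linearity of [sigma] makes this balanced over [S] in [f] and [m], and
    since [H (x)_S M -> C] is bijective it is then well defined on [C].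

    Let then [X1 -> X2 -> X3] be exact, and let [t] in [X2 (x) M] vanish in
    [X3 (x) M]. Its coaction vanishes in [(X3 (x) M) (x) C], so by flatness of
    [C] it comes from [K (x) C], with [K] the kernel of
    [X2 (x) M -> X3 (x) M]. The forms [tau] send [K] into the kernel of
    [X2 -> X3], hence into the image of [X1], so the retraction sends the
    coaction of [t], which it must send to [t] itself, into the image of
    [X1 (x) M] ([comatrix_act_exact], [flat_over_end]). *)

(** * Right modules: kernels, free modules and dual bases *)

Section RightModules.
Variable R : pzRingType.

Lemma rscale0 (X : rmodType R) (a : R) : (0 : X) :* a = 0.
Proof. by apply: (addrI ((0 : X) :* a)); rewrite -rscalerDl !addr0. Qed.

Lemma rscale_suml (X : rmodType R) n (x : 'I_n -> X) (a : R) :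
  (\sum_(i < n) x i) :* a = \sum_(i < n) x i :* a.
Proof. exact: (big_morph _ (rscalerDl a) (rscale0 X a)). Qed.

Lemma rscale_sumr (X : rmodType R) (x : X) n (a : 'I_n -> R) :
  x :* (\sum_(i < n) a i) = \sum_(i < n) x :* a i.
Proof.
apply: (big_morph _ (rscalerDr x)).
by apply: (addrI (x :* 0)); rewrite -rscalerDr !addr0.
Qed.

Lemma tens_suml (X : rmodType R) (Y : lmodType R) n (x : 'I_n -> X) (y : Y) :
  tens (\sum_(i < n) x i) y = \sum_(i < n) tens (x i) y.
Proof.
apply: (big_morph (fun x => tens x y)) => [x' x''|]; last exact: tens0l.
exact: tensDl.
Qed.

Lemma rlinear_comp (X X' X'' : rmodType R) (g : X' -> X'') (f : X -> X') :
  rlinear g -> rlinear f -> rlinear (g \o f).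
Proof.
by move=> [gB gZ] [fB fZ]; split=> [x y|x a] /=; rewrite ?fB ?gB ?fZ ?gZ.
Qed.

End RightModules.

Section Kernel.
Variables (R : pzRingType) (X X' : rmodType R) (f : rhom X X').

Definition rker_pred : {pred X} := fun x => f x == 0.

Lemma rker_zmod_closed : zmod_closed rker_pred.
Proof.
split=> [|x y /eqP fx /eqP fy]; apply/eqP; first exact: zmod_morph0 (rhomB f).
by rewrite rhomB fx fy subrr.
Qed.
HB.instance Definition _ :=
  GRing.isZmodClosed.Build X rker_pred rker_zmod_closed.

Definition rker := {x : X | x \in rker_pred}.
HB.instance Definition _ := [isSub of rker for @sval _ _].
HB.instance Definition _ := [Choice of rker by <:].
HB.instance Definition _ := [SubChoice_isSubZmodule of rker by <:].

Lemma rkerP (x : rker) : f (val x) = 0. Proof. exact/eqP/(valP x). Qed.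

Let rker_rscale_subproof (x : rker) a : val x :* a \in rker_pred.
Proof. by apply/eqP; rewrite rhomZ rkerP rscale0. Qed.

Let rker_rscale (x : rker) a : rker :=
  exist (fun y => y \in rker_pred) _ (rker_rscale_subproof x a).

Let rker_rscalerA x a b :
  rker_rscale (rker_rscale x a) b = rker_rscale x (a * b).
Proof. by apply: val_inj; exact: rscalerA. Qed.
Let rker_rscaler1 x : rker_rscale x 1 = x.
Proof. by apply: val_inj; exact: rscaler1. Qed.
Let rker_rscalerDl a : {morph rker_rscale^~ a : x y / x + y}.
Proof. by move=> x y; apply: val_inj; exact: rscalerDl. Qed.
Let rker_rscalerDr x : {morph rker_rscale x : a b / a + b}.
Proof. by move=> a b; apply: val_inj; exact: rscalerDr. Qed.

HB.instance Definition _ := Zmodule_isRmodule.Build R rker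
  rker_rscalerA rker_rscaler1 rker_rscalerDl rker_rscalerDr.

Definition rker_incl (x : rker) : X := val x.

Lemma rker_incl_rlinear : rlinear rker_incl. Proof. by []. Qed.

Lemma rker_exact : exact_at rker_incl f.
Proof.
move=> x; split=> [/eqP fx|[y <-]]; last exact: rkerP.
by exists (exist (fun y => y \in rker_pred) x fx).
Qed.

End Kernel.

Section FreeModule.
Variables (R : pzRingType) (n : nat).

Definition rfree : Type := {ffun 'I_n -> R}.
HB.instance Definition _ := GRing.Zmodule.on rfree.

Let rfree_rscale (x : rfree) (a : R) : rfree := [ffun i => x i * a].

Let rfree_rscalerA x a b :
  rfree_rscale (rfree_rscale x a) b = rfree_rscale x (a * b).
Proof. by apply/ffunP=> i; rewrite !ffunE mulrA. Qed.
Let rfree_rscaler1 x : rfree_rscale x 1 = x.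
Proof. by apply/ffunP=> i; rewrite ffunE mulr1. Qed.
Let rfree_rscalerDl a : {morph rfree_rscale^~ a : x y / x + y}.
Proof. by move=> x y; apply/ffunP=> i; rewrite !ffunE mulrDl. Qed.
Let rfree_rscalerDr x : {morph rfree_rscale x : a b / a + b}.
Proof. by move=> a b; apply/ffunP=> i; rewrite !ffunE mulrDr. Qed.

HB.instance Definition _ := Zmodule_isRmodule.Build R rfree
  rfree_rscalerA rfree_rscaler1 rfree_rscalerDl rfree_rscalerDr.

Definition rcoord (i : 'I_n) (x : rfree) : R^o := x i.

Lemma rcoord_rlinear i : rlinear (rcoord i).
Proof. by split=> [x y|x a]; rewrite /rcoord !ffunE. Qed.

End FreeModule.

(** The coordinates come from a linear section of the surjection from a free
    module given by a finite generating family. *)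
Lemma dual_basis (R : pzRingType) (X : rmodType R) :
    finitely_generated X -> projective X ->
  exists n (e : 'I_n -> X) (phi : 'I_n -> rhom X R^o),
    forall x, x = \sum_(i < n) e i :* phi i x.
Proof.
move=> [n [e eP]] Xproj.
pose p (a : rfree R n) : X := \sum_(i < n) e i :* a i.
have pP : rlinear p.
  split=> [|a b]; last first.
    by rewrite /p rscale_suml; apply: eq_bigr => i _; rewrite ffunE rscalerA.
  apply: morphD_zmod => a b; rewrite /p -big_split /=; apply: eq_bigr => i _.
  by rewrite ffunE rscalerDr.
have p_surj x : exists a, p a = x.
  have [a ->] := eP x; exists [ffun i => a i].
  by apply: eq_bigr => i _; rewrite ffunE.
have [h hP ph] := Xproj _ _ p id pP p_surj (@rlinear_id _ X).
exists n, e, (fun i => mkrhom (rlinear_comp (rcoord_rlinear R i) hP)) => x.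
by rewrite -[LHS]ph.
Qed.

(** * Generators reflect exactness *)

Section RightEvaluation.
Variables (R : pzRingType) (Y : lmodType R) (tau : Y -> R^o).
Hypothesis tauP : linear tau.

Definition reval (X : rmodType R) (t : X *t Y) : X := tunitr (tmap id tau t).

Lemma reval_tens (X : rmodType R) (x : X) y : reval (tens x y) = x :* tau y.
Proof. by rewrite /reval (tmap_tens (@rlinear_id _ X) tauP) tunitr_tens. Qed.

Lemma revalD (X : rmodType R) : {morph @reval X : s t / s + t}.
Proof.
by move=> s t; rewrite /reval (tmapD (@rlinear_id _ X) tauP) tunitrD.
Qed.

Lemma reval_natural (X X' : rmodType R) (f : X -> X') (t : X *t Y) :
  rlinear f -> reval (tmap f id t) = f (reval t).
Proof.
move=> fP; have idP := @linear_id _ Y.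
elim/tens_ind: t => [x y|s t]; first by rewrite tmap_tens // !reval_tens fP.2.
by rewrite tmapD // !revalD (rlinear_morphD fP) => -> ->.
Qed.

End RightEvaluation.

Section Generator.
Variables (R : pzRingType) (Y : lmodType R).
Variables (n : nat) (e : 'I_n -> Y) (tau : 'I_n -> Y -> R^o).
Hypothesis tauP : forall i, linear (tau i).
Hypothesis tau_e : \sum_(i < n) (tau i (e i) : R) = 1.

Lemma reval_generator (X : rmodType R) (x : X) :
  \sum_(i < n) reval (tau i) (tens x (e i)) = x.
Proof.
under eq_bigr do rewrite reval_tens //.
by rewrite -rscale_sumr tau_e rscaler1.
Qed.

Lemma tens_generator_eq0 (X : rmodType R) (x : X) :
  (forall i, tens x (e i) = 0) -> x = 0.
Proof.
move=> x0; rewrite -(reval_generator x) big1 // => i _.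
by rewrite x0 -(tens0l X (e i)) reval_tens // rscale0.
Qed.

(** To see that [g x = 0] forces [x] into the image of [f], lift each
    [x (x) e i] along [f (x) Y] and recombine the lifts with the forms
    [tau i], which commute with [f]. *)
Lemma generator_reflects_exact (X1 X2 X3 : rmodType R)
    (f : X1 -> X2) (g : X2 -> X3) :
    rlinear f -> rlinear g ->
    exact_at (tmap f (@id Y)) (tmap g (@id Y)) ->
  exact_at f g.
Proof.
move=> fP gP fgP x; have idP := @linear_id _ Y.
split=> [gx|[y <-]]; last first.
  apply: tens_generator_eq0 => i; rewrite -(tmap_tens gP idP); apply/fgP.
  by exists (tens y (e i)); rewrite tmap_tens.
have xe i : exists y, reval (tau i) (tens x (e i)) = f y.
  have /fgP[t <-] : tmap g id (tens x (e i)) = 0.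
    by rewrite tmap_tens // gx tens0l.
  by exists (reval (tau i) t); rewrite reval_natural.
rewrite -(reval_generator x).
elim/big_ind: _ => [|_ _ [y <-] [z <-]|i _].
- by exists 0; apply: zmod_morph0 fP.1.
- by exists (y + z); apply: rlinear_morphD.
- by have [y ->] := xe i; exists y.
Qed.

Lemma flat_generator_faithfully_flat : flat Y -> faithfully_flat Y.
Proof.
move=> Yflat X1 X2 X3 f g fP gP; split; first exact: Yflat.
exact: generator_reflects_exact.
Qed.

End Generator.

(** * Evaluating a right linear form on the left tensor factor *)

Section LeftEvaluation.
Variables (R : pzRingType) (X : rmodType R) (phi : rhom X R^o).
Let phiP := rhomP phi.

Definition leval (Y : lmodType R) (t : X *t Y) : Y := tunitl (tmap phi id t).

Lemma tunitlD (Y : lmodType R) : {morph @tunitl R Y : s t / s + t}.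
Proof.
apply: tliftD; split=> [y a b|a y z|a b y]; first exact: scalerDl.
  exact: scalerDr.
by rewrite scalerA.
Qed.

Lemma leval_tens (Y : lmodType R) x (y : Y) :
  leval (tens x y) = (phi x : R) *: y.
Proof. by rewrite /leval (tmap_tens phiP (@linear_id _ Y)) tunitl_tens. Qed.

Lemma levalD (Y : lmodType R) : {morph @leval Y : s t / s + t}.
Proof. by move=> s t; rewrite /leval (tmapD phiP (@linear_id _ Y)) tunitlD. Qed.

Lemma leval_natural (Y Y' : lmodType R) (g : Y -> Y') (t : X *t Y) :
  linear g -> leval (tmap id g t) = g (leval t).
Proof.
move=> gP; have idP := @rlinear_id _ X.
elim/tens_ind: t => [x y|s t].
  by rewrite tmap_tens // !leval_tens (linear_morphZ gP).
by rewrite tmapD // !levalD (linear_morphD gP) => -> ->.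
Qed.

Lemma leval_rlinear (T : pzRingType) (Y : bimodType R T) :
  rlinear (@leval Y : X *t Y -> Y).
Proof.
split=> [|t a]; first exact/morphD_zmod/levalD.
elim/tens_ind: t => [x y|s t]; first by rewrite rscale_tens !leval_tens bimodA.
by rewrite rscalerDl !levalD rscalerDl => -> ->.
Qed.

Lemma leval_tassoc (T : pzRingType) (Y : bimodType R T) (Z : lmodType T)
    (t : (X *t Y) *t Z) :
  leval (tassoc t) = tmap (@leval Y) id t.
Proof.
have evP := leval_rlinear Y; have idP := @linear_id _ Z.
have D (s' t' : (X *t Y) *t Z) :
    leval (tassoc (s' + t')) = leval (tassoc s') + leval (tassoc t').
  rewrite (tassocD s' t').
  exact: (levalD (Y := Y *t Z) (tassoc s') (tassoc t')).
elim/tens_ind: t => [u z|s t]; last by rewrite D tmapD // => -> ->.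
rewrite tmap_tens //; elim/tens_ind: u => [x y|s t].
  by rewrite tassoc_tens !leval_tens scale_tens.
by rewrite tensDl D (levalD (Y := Y)) tensDl => -> ->.
Qed.

Lemma leval_regular (t : X *t R^o) : leval t = phi (tunitr t).
Proof.
elim/tens_ind: t => [x a|s t].
  by rewrite leval_tens tunitr_tens rhomZ.
by rewrite levalD tunitrD rhomD => -> ->.
Qed.

End LeftEvaluation.

Lemma dual_basis_tens (R : pzRingType) (X : rmodType R) (Y : lmodType R)
    n (e : 'I_n -> X) (phi : 'I_n -> rhom X R^o) :
    (forall x, x = \sum_(i < n) e i :* phi i x) ->
  forall t : X *t Y, t = \sum_(i < n) tens (e i) (leval (phi i) t).
Proof.
move=> eP; elim/tens_ind => [x y|s t hs ht].
  rewrite {1}(eP x) tens_suml; apply: eq_bigr => i _.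
  by rewrite leval_tens tensA.
rewrite {1}hs {1}ht -big_split /=; apply: eq_bigr => i _.
by rewrite levalD tensDr.
Qed.

(** * Colinear maps into the coring and rank one endomorphisms *)

Section Comodules.
Variables (k : comPzRingType) (A : kalgebra k) (C : coring A).
Variable M : comodule C.
Local Notation S := (cend M).
Local Notation H := (chom M (regular_comodule C)).

Lemma tens_with_rlinear (X : rmodType S) (x : X) :
  rlinear (@tens_with _ _ C M X x).
Proof.
split=> [|m a]; last exact: (esym (rscale_tens x (m : over_end M) a)).
by apply: morphD_zmod => m n; exact: (tensDr x (m : over_end M) n).
Qed.

Lemma tensor_coact_natural (X X' : rmodType S) (g : X -> X')
    (t : X *t over_end M) :
    rlinear g ->
  tensor_coact (tmap g id t) =
  tmap (tmap g id : X *t over_end M -> X' *t over_end M) id (tensor_coact t).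
Proof.
move=> gP; have idP := @linear_id _ C; have idM := @linear_id _ (over_end M).
have gMP := tmap_rlinear gP (over_end M).
elim/tens_ind: t => [x m|s t].
  rewrite tmap_tens // !tensor_coact_tens.
  rewrite (tmap_comp (tens_with_rlinear x) gMP idP idP).
  by apply: tmap_ext => // m'; rewrite /= /tens_with tmap_tens.
by rewrite tmapD // !tensor_coactD tmapD // => -> ->.
Qed.

(** [C] is cofree over [A]: with [counit_form] below, this is the bijection
    between the right [A]-linear forms on [M] and the colinear maps to [C]. *)
Section ColinearForm.
Variable phi : rhom M A^o.

Definition colinear_form (m : M) : regular_comodule C := leval phi (coact m).

(** Coassociativity, after applying [phi] to the first factor. *)
Lemma colinear_formP : colinear colinear_form.
Proof.
have fP : rlinear colinear_form.
  exact: (rlinear_comp (leval_rlinear phi C) (@coact_rlinear _ _ C M)).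
split=> // m.
have idP := @linear_id _ C.
have -> : coact (colinear_form m) = @comul _ _ C (leval phi (coact m)) by [].
rewrite -(leval_natural phi _ (@comul_linear _ _ C)) -coactA leval_tassoc.
exact: (tmap_comp (@coact_rlinear _ _ C M) (leval_rlinear phi C) idP idP).
Qed.

Lemma counit_colinear_form m : counit (colinear_form m) = phi m.
Proof.
rewrite /colinear_form -(leval_natural phi _ (@counit_linear _ _ C)).
by rewrite leval_regular coact_counit.
Qed.

End ColinearForm.

Definition counit_form (f : H) : rhom M A^o :=
  mkrhom (rlinear_comp (@counit_rlinear _ _ C) (chomP f).1).

(** The Galois map is left [A]-linear for this action of [A] on the colinear
    maps, which is what makes the retraction below balanced over [A]. *)
Lemma scale_colinear (a : A) (f : H) :
  colinear (fun m => a *: (f m : C) : regular_comodule C).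
Proof.
have [fP fC] := chomP f.
have aP : rlinear (fun c : C => a *: c).
  by split=> [x y|x b]; rewrite ?scalerBr ?bimodA.
have idP := @linear_id _ C.
split=> [|m]; first exact: (rlinear_comp aP fP).
have -> : coact (a *: (f m : C) : regular_comodule C) =
    a *: @comul _ _ C (f m) := linear_morphZ (@comul_linear _ _ C) _ _.
rewrite -(tmap_comp fP aP idP idP).
exact: (congr1 (fun t : C *t C => a *: t) (fC m)).
Qed.

Definition rank1_fun (m : M) (phi : rhom M A^o) (n : M) : M := m :* phi n.

Lemma rank1_subproof m phi : rlinear (rank1_fun m phi).
Proof.
split=> [|n a]; last by rewrite /rank1_fun rhomZ rscalerA.
by apply: morphD_zmod => n n'; rewrite /rank1_fun rhomD rscalerDr.
Qed.

Definition rank1 m phi : rend M := mkrhom (rank1_subproof m phi).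

Lemma rend_eq (f g : rend M) : (forall m, f m = g m) -> f = g.
Proof. by move=> fg; apply: val_inj; apply/boolp.funext. Qed.

Lemma sum_rendE n (f : 'I_n -> rend M) m :
  (\sum_(i < n) f i : rend M) m = \sum_(i < n) f i m.
Proof. exact: (big_morph (fun g : rend M => g m)). Qed.

Lemma rank1_dual_basis n (e : 'I_n -> M) (phi : 'I_n -> rhom M A^o) :
    (forall m, m = \sum_(i < n) e i :* phi i m) ->
  \sum_(i < n) rank1 (e i) (phi i) = 1.
Proof. by move=> eP; apply: rend_eq => m; rewrite sum_rendE; apply/esym/eP. Qed.

(** * The forms on the comodule given by a splitting *)

Section LeftSplit.
Variable sigma : rend M -> S.
Hypothesis sigmaP : left_module_map (cend_incl M) sigma.
Hypothesis sigma1 : sigma 1 = 1.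

Definition end_form (phi : rhom M A^o) (m : over_end M) : S^o :=
  sigma (rank1 m phi).

Lemma end_form_linear phi : linear (end_form phi).
Proof.
move=> s m n; have [sB sZ] := sigmaP.
rewrite -[RHS]/(s * sigma (rank1 m phi) + sigma (rank1 n phi) : S) /end_form.
rewrite -sZ -(zmod_morphD sB); congr (sigma _).
apply: rend_eq => x.
have -> : (cend_incl M s * rank1 m phi + rank1 n phi : rend M) x =
  cend_fun s (m :* phi x) + rank1 n phi x by [].
rewrite (cendP s).1.2.
exact: rscalerDl.
Qed.

Section DualBasis.
Variables (n : nat) (e : 'I_n -> M) (phi : 'I_n -> rhom M A^o).
Hypothesis eP : forall m, m = \sum_(i < n) e i :* phi i m.

Lemma end_form_dual_basis : \sum_(i < n) (end_form (phi i) (e i) : S) = 1.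
Proof.
rewrite -sigma1 -(rank1_dual_basis eP); symmetry.
exact: (big_morph sigma (zmod_morphD sigmaP.1) (zmod_morph0 sigmaP.1)).
Qed.


End DualBasis.
End LeftSplit.

(** * The coaction splits naturally, and flatness descends *)

Section Splitting.
Variable sigma : rend M -> S.
Hypothesis sigmaL : left_module_map (cend_incl M) sigma.
Hypothesis sigmaR : right_module_map (cend_incl M) sigma.
Hypothesis sigma1 : sigma 1 = 1.

Definition galois_form (f : H) : over_end M -> S^o :=
  end_form sigma (counit_form f).
Local Notation tau := galois_form.

Let tauP f : linear (tau f) := end_form_linear sigmaL (counit_form f).

Lemma galois_formD (f g : H) (m : over_end M) :
  tau (f + g) m = (tau f m : S) + tau g m.
Proof.
rewrite /galois_form /end_form -(zmod_morphD sigmaL.1); congr (sigma _).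
apply: rend_eq => x; rewrite [RHS](_ : _ = rank1 m (counit_form f) x +
  rank1 m (counit_form g) x) // -rscalerDr; congr (_ :* _).
exact: (rlinear_morphD (@counit_rlinear _ _ C) (f x) (g x)).
Qed.

(** Right linearity of [sigma] enters through this identity, which makes
    [comatrix_act] below balanced over [S]. *)
Lemma galois_form_rscale (f : H) (s : S) (m : over_end M) :
  tau (f :* s) m = (tau f m : S) * s.
Proof.
have [_ sZ] := sigmaR; rewrite /galois_form /end_form -sZ; congr (sigma _).
exact: rend_eq.
Qed.

Lemma galois_form_scale (a : A) (f : H) (m : over_end M) :
  tau (mkchom (scale_colinear a f)) m = tau f (m :* a).
Proof.
congr (sigma _); apply: rend_eq => x.
rewrite [RHS](rscalerA (m : M)); congr (_ :* _).
exact: (linear_morphZ (@counit_linear _ _ C)).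
Qed.

Section Retraction.
Variable X : rmodType S.
Local Notation XM := (X *t over_end M).

Let revalD f := revalD (tauP f) (X := X).

Lemma reval_galois_formD (f g : H) (t : XM) :
  reval (tau (f + g)) t = reval (tau f) t + reval (tau g) t.
Proof.
elim/tens_ind: t => [x m|s t]; last by rewrite !revalD addrACA => -> ->.
by rewrite !reval_tens // galois_formD rscalerDr.
Qed.

Lemma reval_galois_form_rscale (f : H) (s : S) (t : XM) :
  reval (tau (f :* s)) t = reval (tau f) t :* s.
Proof.
elim/tens_ind: t => [x m|u t]; last by rewrite !revalD rscalerDl => -> ->.
by rewrite !reval_tens // galois_form_rscale rscalerA.
Qed.

Lemma reval_galois_form_scale (a : A) (f : H) (t : XM) :
  reval (tau (mkchom (scale_colinear a f))) t = reval (tau f) (t :* a).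
Proof.
elim/tens_ind: t => [x m|u t]; last by rewrite rscalerDl !revalD => -> ->.
by rewrite rscale_tens !reval_tens // galois_form_scale.
Qed.

(** The retraction of the coaction on [t (x) c], with [c] read in the comatrix
    coring [H (x)_S M] through the Galois isomorphism. *)
Definition comatrix_act (t : XM) : H *t over_end M -> XM :=
  tlift (fun (f : H) (n : over_end M) => tens (reval (tau f) t) n : XM).

Let act_balanced t :
  balanced (fun (f : H) (n : over_end M) => tens (reval (tau f) t) n : XM).
Proof.
split=> [n f g|f n n'|f s n]; last by rewrite reval_galois_form_rscale tensA.
  by rewrite reval_galois_formD tensDl.
exact: tensDr.
Qed.

Lemma comatrix_act_tens t f n :
  comatrix_act t (tens f n) = tens (reval (tau f) t) n.
Proof. exact: (tlift_tens (act_balanced t)). Qed.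

Lemma comatrix_actDr t : {morph comatrix_act t : u v / u + v}.
Proof. exact: (tliftD (act_balanced t)). Qed.

Lemma comatrix_actDl (h : H *t over_end M) :
  {morph comatrix_act^~ h : s t / s + t}.
Proof.
move=> s t; elim/tens_ind: h => [f n|u v].
  by rewrite !comatrix_act_tens revalD tensDl.
by rewrite !comatrix_actDr => -> ->; rewrite addrACA.
Qed.

(* the Galois map and its inverse, as maps of abelian groups *)
Variables (gamma : H *t over_end M -> C) (gamma' : C -> H *t over_end M).
Hypothesis gammaD : {morph gamma : s t / s + t}.
Hypothesis gamma_tens : forall (f : H) (m : over_end M), gamma (tens f m) = f m.
Hypothesis gammaK : cancel gamma gamma'.
Hypothesis gammaK' : cancel gamma' gamma.

Let gamma'_chom (f : H) (n : M) : gamma' (f n) = tens f (n : over_end M).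
Proof. by rewrite -[f n](gamma_tens f (n : over_end M)) gammaK. Qed.

Let gamma'D : {morph gamma' : c d / c + d}.
Proof. by move=> c d; apply: (can_inj gammaK); rewrite gammaD !gammaK'. Qed.

Definition coact_retract : XM *t C -> XM :=
  tlift (fun (t : XM) (c : C) => comatrix_act t (gamma' c)).

Let retract_balanced :
  balanced (fun (t : XM) (c : C) => comatrix_act t (gamma' c)).
Proof.
split=> [c s t|t c d|t a c]; first exact: comatrix_actDl.
  by rewrite gamma'D comatrix_actDr.
rewrite -[in RHS](gammaK' c); elim/tens_ind: (gamma' c) => [f n|u v hu hv].
  rewrite gamma_tens comatrix_act_tens -reval_galois_form_scale.
  rewrite -[LHS]comatrix_act_tens; congr (comatrix_act t _).
  exact: (esym (gamma'_chom (mkchom (scale_colinear a f)) n)).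
by rewrite comatrix_actDr hu hv -comatrix_actDr -gamma'D gammaD scalerDr.
Qed.

Lemma coact_retract_tens t c :
  coact_retract (tens t c) = comatrix_act t (gamma' c).
Proof. exact: (tlift_tens retract_balanced). Qed.

Lemma coact_retractD : {morph coact_retract : s t / s + t}.
Proof. exact: (tliftD retract_balanced). Qed.

(** Since [m = sum_i e_i (phi_i m)], the coaction of [m] is
    [sum_i e_i (x) f_i m] with [f_i] the colinear map of [phi_i], so that of
    [x (x) m] is sent to [sum_i x (tau_(phi_i) e_i) (x) m = x (x) m]. *)
Lemma coact_retractK n (e : 'I_n -> M) (phi : 'I_n -> rhom M A^o) :
    (forall m, m = \sum_(i < n) e i :* phi i m) ->
  cancel (@tensor_coact _ _ C M X) coact_retract.
Proof.
move=> eP; elim/tens_ind => [x m|s t hs ht]; last first.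
  by rewrite tensor_coactD coact_retractD hs ht.
pose f i : H := mkchom (colinear_formP (phi i)).
have rankE i : rank1 (e i) (counit_form (f i)) = rank1 (e i) (phi i).
  by apply: rend_eq => m'; congr (_ :* _); exact: counit_colinear_form.
have coactE : coact (m : M) = \sum_(i < n) tens (e i) (f i m : C).
  exact: (dual_basis_tens eP (coact (m : M))).
have xP : rlinear (tens_with x) := tens_with_rlinear x.
have idP := @linear_id _ C.
rewrite tensor_coact_tens coactE.
rewrite (big_morph (tmap (tens_with x) id) (tmapD xP idP)
  (zmod_morph0 (tmapB xP idP))).
rewrite (big_morph coact_retract coact_retractD
  (zmod_morph0 (morphD_zmod coact_retractD))).
rewrite -[RHS](congr1 (fun x' => tens x' m) (rscaler1 x)).
rewrite -(end_form_dual_basis sigmaL sigma1 eP) rscale_sumr tens_suml.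
apply: eq_bigr => i _.
rewrite tmap_tens // coact_retract_tens gamma'_chom comatrix_act_tens.
by rewrite reval_tens // /galois_form /end_form rankE.
Qed.

End Retraction.

(** The coefficients of [comatrix_act t] are values on [t] of forms that commute
    with [g], hence lie in the kernel of [g]. *)
Lemma comatrix_act_exact (X1 X2 X3 : rmodType S) (f : X1 -> X2) (g : X2 -> X3)
    (t : X2 *t over_end M) (h : H *t over_end M) :
    rlinear f -> rlinear g -> exact_at f g -> tmap g id t = 0 ->
  exists s, tmap f id s = comatrix_act t h.
Proof.
move=> fP gP fg gt0; have idP := @linear_id _ (over_end M).
elim/tens_ind: h => [phi n|u v [s su] [s' sv]]; last first.
  by exists (s + s'); rewrite tmapD // comatrix_actDr su sv.
have /fg[x fx] : g (reval (tau phi) t) = 0.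
  rewrite -(reval_natural (tauP phi)) // gt0.
  exact: (zmod_morph0 (morphD_zmod (revalD (tauP phi) (X := X3)))).
by exists (tens x n); rewrite tmap_tens // comatrix_act_tens fx.
Qed.

(** The coaction is a natural split embedding of [X (x)_S M] into
    [(X (x)_S M) (x)_A C], on which the flatness of [C] can be used without
    knowing that of [M]. *)
Lemma flat_over_end : galois M -> flat C -> flat (over_end M).
Proof.
move=> [Mfg Mproj [_ [gamma' [_ gammaK gammaK']]]] Cflat.
have [n [e [phi eP]]] := dual_basis Mfg Mproj.
move=> X1 X2 X3 f g fP gP fg t; have idP := @linear_id _ (over_end M).
split=> [gt0|[s <-]]; last first.
  elim/tens_ind: s => [x m|s s' hs hs'].
    by rewrite !tmap_tens // (iffRL (fg _)) ?tens0l //; exists x.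
  by rewrite !tmapD // hs hs' addr0.
pose gM := mkrhom (tmap_rlinear gP (over_end M)).
have inclP := rker_incl_rlinear gM; have idC := @linear_id _ C.
have : tmap gM id (tensor_coact t) = 0 :> (X3 *t over_end M) *t C.
  rewrite -[LHS]tensor_coact_natural // gt0.
  exact: (zmod_morph0 (morphD_zmod (@tensor_coactD _ _ C M X3))).
case/(Cflat _ _ _ _ _ inclP (rhomP gM) (rker_exact gM)) => w wt.
have gammaD : {morph @galois_map _ _ C M : s s' / s + s'}.
  apply: tliftD; split=> [m h h'|h m m'|h s m] //.
  exact: (zmod_morphD (chomP h).1.1 m m').
have gamma_tens := @galois_map_tens _ _ C M.
rewrite -(coact_retractK gammaD gamma_tens gammaK gammaK' eP t) -wt.
have retractD := coact_retractD gammaD gamma_tens gammaK gammaK' (X := X2).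
elim/tens_ind: w {wt} => [u c|w w' [s sw] [s' sw']]; last first.
  by exists (s + s'); rewrite !tmapD // retractD sw sw'.
rewrite tmap_tens // (coact_retract_tens gammaD gamma_tens) //.
exact: (comatrix_act_exact _ fP gP fg (rkerP u)).
Qed.

End Splitting.
End Comodules.

Theorem proposition7p3 (k : comPzRingType) (A : kalgebra k) (C : coring A)
    (M : comodule C) (hM : galois M) :
    (flat (over_end M) /\
     (exists sigma : rend M -> cend M,
        left_module_map (cend_incl M) sigma /\ sigma 1 = 1)) \/
    (flat C /\ split_extension (cend_incl M)) ->
  faithfully_flat (over_end M).
Proof.
move=> hyp; have [Mfg Mproj _] := hM.
have [n [e [phi eP]]] := dual_basis Mfg Mproj.
have ff (sigma : rend M -> cend M) : left_module_map (cend_incl M) sigma ->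
    sigma 1 = 1 -> flat (over_end M) -> faithfully_flat (over_end M).
  move=> sigmaL sigma1.
  exact: (flat_generator_faithfully_flat
    (fun i => end_form_linear sigmaL (phi i))
    (end_form_dual_basis sigmaL sigma1 eP)).
case: hyp => [[Mflat [sigma [sigmaL sigma1]]] |
    [Cflat [sigma [sigmaL sigmaR sigma1]]]].
  exact: ff sigmaL sigma1 Mflat.
exact: ff sigmaL sigma1 (flat_over_end sigmaL sigmaR sigma1 hM Cflat).
Qed.
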